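(* Let $X=\{\lambda_1,\dots,\lambda_N\}$ be the set of vertices of a convex polygon $P\subseteq\mathbb{C}$ and let $d=(d_1,d_2,\dots)$ be a sequence of complex numbers satisfying $d_n\in P$ for all $n\geq 1$, together with the summability condition $$\sum_{n=1}^\infty |f(d_n)|<\infty,$$ where $f(z)=(z-\lambda_1)(z-\lambda_2)\cdots(z-\lambda_N)$. Then $d\in \mathrm{Lim}^1(X)$; and if $d$ is the diagonal of an operator in $\mathcal{N}(X)$, then its renormalized sum satisfies $s(d)=0$ in $\Gamma_X$.
   Context: Here $N\ge 2$, the points $\lambda_1,\dots,\lambda_N$ are distinct, none of them is a convex combination of the others, and $P$ is their convex hull (when $N=2$, $P$ is a line segment). $\mathrm{Lim}^1(X)$ is the set of all bounded complex sequences $a=(a_n)_{n\ge1}$ with $\sum_{n=1}^\infty d(a_n,X)<\infty$, where $d(z,X)=\min_{\lambda\in X}|z-\lambda|$. Equivalently, there is a sequence $x=(x_n)$ with $x_n\in X$ for all $n$ and $\sum_n|a_n-x_n|<\infty$. $K_X$ is the additive subgroup of $\mathbb{C}$ of all $z=\nu_1\lambda_1+\cdots+\nu_N\lambda_N$ with $\nu_1,\dots,\nu_N\in\mathbb{Z}$ and $\nu_1+\cdots+\nu_N=0$, and $\Gamma_X=\mathbb{C}/K_X$ (quotient of abelian groups). For $a\in\mathrm{Lim}^1(X)$ the renormalized sum $s(a)\in\Gamma_X$ is the coset $\sum_{n=1}^\infty(a_n-x_n)+K_X$, where $x=(x_n)$ is any sequence in $X$ with $\sum_n|a_n-x_n|<\infty$;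 the coset does not depend on the choice of $x$. $H$ is a separable infinite-dimensional complex Hilbert space, and $\mathcal{N}(X)$ is the set of all normal operators $A\in\mathcal{B}(H)$ with $\sigma(A)=\sigma_e(A)=X$, where $\sigma_e$ denotes the essential spectrum (i.e. the spectrum of $A$ is $X$ and every point of $X$ is an eigenvalue of infinite multiplicity). A sequence $d$ is the diagonal of an operator $A$ if $d_n=\langle Ae_n,e_n\rangle$ for all $n\ge1$, relative to an orthonormal basis $e_1,e_2,\dots$ of $H$. *)

(* Defs.v *)
From HB Require Import structures.
From mathcomp Require Import all_boot all_order all_algebra.
From mathcomp Require Import sesquilinear generic_quotient ring_quotient.
From mathcomp Require Import complex.
From mathcomp Require Import all_classical all_reals all_analysis.
Import Order.TTheory GRing.Theory Num.Theory.
Import numFieldNormedType.Exports.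

Set Implicit Arguments.
Unset Strict Implicit.
Unset Printing Implicit Defensive.

Local Open Scope classical_set_scope.
Local Open Scope ring_scope.
Local Open Scope complex_scope.

(* Sequences (a_n)_{n >= 1} are indexed from 0, i.e. a_{n+1} is [a n].        *)

Section ComplexSequences.
Variable R : realType.
Implicit Types (a x : nat -> R[i]) (X : set R[i]).

(* The modulus with values in R; the norm `|z| of R[i] lives in R[i] itself.  *)
Definition modulus (z : R[i]) : R := complex.Re `|z|.

Definition abs_summable a : Prop :=
  (\sum_(0 <= n <oo) (modulus (a n))%:E < +oo)%E.

(* The infimum is attained when X is finite and nonempty.                     *)
Definition dist (z : R[i]) X : R := inf [set modulus (z - l) | l in X].

Definition Lim1 X : set (nat -> R[i]) :=
  [set a | (exists M : R, forall n, modulus (a n) <= M) /\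
           (\sum_(0 <= n <oo) (dist (a n) X)%:E < +oo)%E].

(* R[i]^o is R[i] equipped with the topology given by its norm.               *)
Definition csum a : R[i] := limn (series (a : nat -> R[i]^o)).

Definition approximants X a : set (nat -> R[i]) :=
  [set x | (forall n, X (x n)) /\ abs_summable (fun n => a n - x n)].

Lemma modulusE (z : R[i]) : `|z| = (modulus z)%:C.
Proof. by []. Qed.

Lemma modulus_ge0 (z : R[i]) : 0 <= modulus z.
Proof. by rewrite -ler0c -modulusE normr_ge0. Qed.

Lemma modulusB (u v : R[i]) : modulus (u - v) = modulus (v - u).
Proof. by rewrite /modulus distrC. Qed.

Lemma modulusD_le (u v : R[i]) : modulus (u + v) <= modulus u + modulus v.
Proof. by rewrite -lecR rmorphD /= -!modulusE ler_normD. Qed.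

Lemma norm_Re_le (z : R[i]) : `|complex.Re z| <= modulus z.
Proof. by rewrite -lecR -modulusE normc_ge_Re. Qed.

Lemma norm_imaginary : `|'i%C : R[i]| = 1.
Proof. by rewrite normc_def /= expr0n expr1n add0r sqrtr1. Qed.

Lemma norm_Im_le (z : R[i]) : `|complex.Im z| <= modulus z.
Proof.
have -> : modulus z = modulus (z * 'i%C).
  by rewrite /modulus normrM norm_imaginary mulr1.
by apply: le_trans (norm_Re_le _); rewrite ReiNIm normrN.
Qed.

Lemma modulus_le_ReIm (z : R[i]) :
  modulus z <= `|complex.Re z| + `|complex.Im z|.
Proof.
rewrite -lecR rmorphD /= -modulusE [in `|z|](complexE z).
apply: le_trans (ler_normD _ _) _; rewrite normrM norm_imaginary mul1r.
by rewrite !normc_def /= !expr0n /= !addr0 !sqrtr_sqr.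
Qed.

Lemma cvgn_modulus_series a :
  abs_summable a -> cvgn (series (fun n => modulus (a n))).
Proof.
move=> sum_a; apply: nondecreasing_is_cvgn.
  by apply: nondecreasing_series => n *; exact: modulus_ge0.
have ge0 n : (0 <= (modulus (a n))%:E)%E by rewrite lee_fin modulus_ge0.
exists (fine (\sum_(0 <= n <oo) (modulus (a n))%:E)%E) => _ [n _ <-].
rewrite -lee_fin fineK; last first.
  by rewrite ge0_fin_numE //; exact: nneseries_ge0.
rewrite /series /= -sumEFin; exact: nneseries_lim_ge.
Qed.

Lemma abs_summable_cvgn a :
  abs_summable a -> cvgn (series (a : nat -> R[i]^o)).
Proof.
move=> /cvgn_modulus_series cvg_a.
have cvgP (p : R[i] -> R) : (forall z, `|p z| <= modulus z) ->
    cvgn (series (fun n => p (a n))).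
  move=> p_le; apply: normed_cvg; apply: series_le_cvg cvg_a => n.
  - exact: normr_ge0.
  - exact: modulus_ge0.
  - exact: p_le.
have /cvg_ex[/= u cvg_u] := cvgP (@complex.Re R) norm_Re_le.
have /cvg_ex[/= v cvg_v] := cvgP (@complex.Im R) norm_Im_le.
apply/cvg_ex; exists (u +i* v : R[i]^o).
apply/cvgrPdist_lt => /= eps eps_gt0.
have /complex_realP[e epsE] : eps \is Num.real by rewrite gtr0_real.
rewrite epsE ltcR in eps_gt0 *.
have e2_gt0 : 0 < e / 2 by rewrite divr_gt0.
move/cvgrPdist_lt : cvg_u => /(_ _ e2_gt0) near_u.
move/cvgrPdist_lt : cvg_v => /(_ _ e2_gt0) near_v.
near=> n.
rewrite modulusE ltcR; apply: le_lt_trans (modulus_le_ReIm _) _.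
rewrite [e]splitr; apply: ltrD.
- rewrite raddfB /= /series /= raddf_sum; near: n; exact: near_u.
- rewrite raddfB /= /series /= raddf_sum; near: n; exact: near_v.
Unshelve. all: by end_near. Qed.

End ComplexSequences.

Section FiniteSets.
Variables (R : realType) (N : nat) (lam : 'I_N -> R[i]).

Definition convex_hull (J : {set 'I_N}) : set R[i] :=
  [set z | exists t : 'I_N -> R,
     [/\ forall i, 0 <= t i, \sum_(i in J) t i = 1
       & z = \sum_(i in J) (t i)%:C * lam i]].

Definition convex_position : Prop :=
  injective lam /\ forall i, ~ convex_hull [set~ i]%SET (lam i).

Definition zero_sum_combs : {pred R[i]} :=
  fun z => `[< exists nu : 'I_N -> int,
                 \sum_i nu i = 0 /\ z = \sum_i lam i *~ nu i >].

Lemma zero_sum_combs_zmod_closed : zmod_closed zero_sum_combs.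
Proof.
split=> [|u v /asboolP[m [m0 ->]] /asboolP[n [n0 ->]]]; apply/asboolP.
  exists (fun=> 0); split; first by rewrite big1.
  by rewrite big1 // => i _; rewrite mulr0z.
exists (fun i => m i - n i); split; first by rewrite sumrB m0 n0 subr0.
by rewrite -sumrB; apply: eq_bigr => i _; rewrite mulrzBr.
Qed.

HB.instance Definition _ :=
  GRing.isZmodClosed.Build R[i] zero_sum_combs zero_sum_combs_zmod_closed.

Definition Gamma : Type :=
  Quotient.quot zero_sum_combs.

Definition coset (z : R[i]) : Gamma := (\pi z)%qT.

(* [xget] picks some approximant x: there is one when a is in Lim^1
   ([Lim1_approximants]), and the coset does not depend on the choice of x
   ([renorm_sumE]).                                                           *)
Definition renorm_sum (a : nat -> R[i]) : Gamma :=
  let x := xget (fun=> 0) (approximants (range lam) a) in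
  coset (csum (fun n => a n - x n)).

Lemma dist_attained (z : R[i]) : (0 < N)%N ->
  exists i, dist z (range lam) = modulus (z - lam i).
Proof.
move=> N_gt0; pose i0 := Ordinal N_gt0.
have [i _ i_min] := @Order.TotalTheory.arg_minP _ _ _ i0 xpredT
  (fun i => modulus (z - lam i)) isT.
exists i; apply/eqP; rewrite eq_le; apply/andP; split.
  apply: ge_inf; last by exists (lam i) => //; exists i.
  by exists 0 => _ [l _ <-]; exact: modulus_ge0.
apply: lb_le_inf; first by exists (modulus (z - lam i)), (lam i) => //; exists i.
by move=> _ [_ [j _ <-] <-]; exact: (i_min j).
Qed.

Lemma Lim1_approximants a : (0 < N)%N ->
  Lim1 (range lam) a -> approximants (range lam) a !=set0.
Proof.
move=> N_gt0 [_ sum_a].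
have [i iP] := choice (fun n => dist_attained (a n) N_gt0).
exists (fun n => lam (i n)); split; first by move=> n; exists (i n).
rewrite /abs_summable -(@eq_eseriesr _ (fun n => (dist (a n) (range lam))%:E)) //.
by move=> n _; rewrite iP.
Qed.

Lemma range_gap : exists2 delta : R, 0 < delta &
  forall i j, modulus (lam i - lam j) < delta -> lam i = lam j.
Proof.
pose g (p : 'I_N * 'I_N) := modulus (lam p.1 - lam p.2).
exists (\big[Num.min/1]_(p | g p != 0) g p).
  apply: lt_bigmin => // p; rewrite lt_neqAle modulus_ge0 andbT eq_sym.
  by [].
move=> i j; have [gij0 _|gij0 /lt_le_trans] := eqVneq (g (i, j)) 0.
  apply/eqP; rewrite -subr_eq0 -normr_eq0 modulusE; apply/eqP.
  by rewrite -[modulus _]/(g (i, j)) gij0.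
by move=> /(_ _ (@bigmin_le_cond _ _ _ 1 _ (fun p => g p != 0) g gij0)); rewrite ltxx.
Qed.

Lemma zero_sum_combsB i j : lam i - lam j \in zero_sum_combs.
Proof.
have sum1 k (c : 'I_N -> R[i]) : \sum_l c l *~ (l == k)%:R = c k.
  rewrite (bigD1 k) //= eqxx mulr1z big1 ?addr0 // => l /negPf ->.
  by rewrite mulr0z.
apply/asboolP; exists (fun k => (k == i)%:R - (k == j)%:R); split.
  have sum1' k : \sum_l ((l == k)%:R : int) = 1.
    by rewrite (bigD1 k) //= eqxx big1 ?addr0 // => l /negPf ->.
  by rewrite sumrB !sum1' subrr.
rewrite -[in LHS](sum1 i lam) -[in LHS](sum1 j lam) -sumrB.
by apply: eq_bigr => k _; rewrite mulrzBr.
Qed.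

Lemma approximants_eventually_eq a x y :
  approximants (range lam) a x -> approximants (range lam) a y ->
  exists n0, forall n, (n0 <= n)%N -> x n = y n.
Proof.
move=> [X_x sum_x] [X_y sum_y]; have [delta delta_gt0 gap] := range_gap.
have d2_gt0 : 0 < delta / 2 by rewrite divr_gt0.
have /cvgrPdist_lt/(_ _ d2_gt0) near_x :=
  cvg_series_cvg_0 (cvgn_modulus_series sum_x).
have /cvgrPdist_lt/(_ _ d2_gt0) near_y :=
  cvg_series_cvg_0 (cvgn_modulus_series sum_y).
have [n0 _ n0P] : \forall n \near \oo, x n = y n.
  near=> n.
  have [i _ xE] := X_x n; have [j _ yE] := X_y n.
  rewrite -xE -yE; apply: gap; rewrite xE yE.
  have -> : x n - y n = (a n - y n) + (x n - a n).
    by rewrite [RHS]addrC addrA subrK.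
  apply: le_lt_trans (modulusD_le _ _) _.
  rewrite (modulusB (x n)) [delta]splitr; apply: ltrD.
  - rewrite -[X in X < _]ger0_norm ?modulus_ge0 // -normrN -[- _]sub0r.
    by near: n; exact: near_y.
  - rewrite -[X in X < _]ger0_norm ?modulus_ge0 // -normrN -[- _]sub0r.
    by near: n; exact: near_x.
by exists n0 => n le_n; exact: n0P.
Unshelve. all: by end_near. Qed.

Lemma renorm_sumE a x : approximants (range lam) a x ->
  renorm_sum a = coset (csum (fun n => a n - x n)).
Proof.
rewrite /renorm_sum; set y := xget _ _ => apx.
have apy : approximants (range lam) a y by apply: xgetI apx.
have [n0 xy] := approximants_eventually_eq apx apy.
case: apx apy => [X_x sum_x] [X_y _].
pose k := \sum_(0 <= n < n0) (x n - y n).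
have k_in : k \in zero_sum_combs.
  apply: rpred_sum => n _; have [i _ <-] := X_x n; have [j _ <-] := X_y n.
  exact: zero_sum_combsB.
suff -> : csum (fun n => a n - y n) = csum (fun n => a n - x n) + k.
  by apply/eqP; rewrite -Quotient.idealrBE addrC addKr.
have cvg_x := abs_summable_cvgn sum_x.
have cvg_xk : (fun n => series (fun n => a n - x n : R[i]^o) n + k) @ \oo
    --> (csum (fun n => a n - x n) + k : R[i]^o).
  by apply: cvgD; [exact: cvg_x | exact: cvg_cst].
have cvg_y : series (fun n => a n - y n : R[i]^o) @ \oo
    --> (csum (fun n => a n - x n) + k : R[i]^o).
  apply: cvg_trans cvg_xk; apply: near_eq_cvg; near=> n.
  have le_n : (n0 <= n)%N by near: n; exists n0.
  have -> : k = \sum_(0 <= l < n) (x l - y l).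
    rewrite (big_cat_nat (n := n0)) //= [X in _ + X]big_nat_cond.
    rewrite [X in _ + X]big1 ?addr0 // => l /andP[/andP[le_l _] _].
    by rewrite xy // subrr.
  rewrite /series /= -big_split /=; apply: eq_bigr => l _.
  by rewrite addrA subrK.
exact: (cvg_lim (@norm_hausdorff R[i] R[i]^o) cvg_y).
Unshelve. all: by end_near. Qed.

End FiniteSets.

Section HilbertSpace.
Variables (R : realType) (H : completeNormedModType R[i]).
Variable ip : {dot H for Num.conj}.
Implicit Types A B : {linear H -> H}.

(* The norm of H is the one given by ip: together with the completeness of H
   this makes (H, ip) a complex Hilbert space.                                *)
Definition norm_of_dot : Prop := forall x : H, `|x| ^+ 2 = ip x x.

Definition separable_space : Prop :=
  exists2 D : set H, countable D & dense D.

Definition infinite_dimensional : Prop :=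
  forall (n : nat) (v : 'I_n -> H),
    exists x : H, forall c : 'I_n -> R[i], x <> \sum_i c i *: v i.

Definition bounded_op A : Prop :=
  exists M : R[i], forall x, `|A x| <= M * `|x|.

Definition is_adjoint A B : Prop := forall x y, ip (A x) y = ip x (B y).

Definition normal_op A : Prop :=
  exists B, [/\ bounded_op B, is_adjoint A B & forall x, A (B x) = B (A x)].

Definition spectrum A : set R[i] :=
  [set z | ~ exists B, [/\ bounded_op B,
     forall x, B (A x - z *: x) = x & forall x, A (B x) - z *: B x = x]].

Definition compact_op (T : H -> H) : Prop :=
  precompact (T @` [set x | `|x| <= 1]).

(* The spectrum of the image of A in the Calkin algebra.                      *)
Definition ess_spectrum A : set R[i] :=
  [set z | ~ exists B, [/\ bounded_op B,
     compact_op (fun x => B (A x - z *: x) - x)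
     & compact_op (fun x => A (B x) - z *: B x - x)]].

Definition normal_with_spectrum (X : set R[i]) : set {linear H -> H} :=
  [set A | [/\ bounded_op A, normal_op A, spectrum A = X & ess_spectrum A = X]].

Definition orthonormal_basis (e : nat -> H) : Prop :=
  (forall i j, ip (e i) (e j) = (i == j)%:R) /\
  dense [set x | exists n (c : 'I_n -> R[i]), x = \sum_i c i *: e i].

Definition is_diagonal (d : nat -> R[i]) A : Prop :=
  exists2 e, orthonormal_basis e & forall n, d n = ip (A (e n)) (e n).

End HilbertSpace.

(* Main.v *)
Require Import Defs.
From mathcomp Require Import all_boot all_order all_algebra.
From mathcomp Require Import sesquilinear spectral complex.
From mathcomp Require Import all_classical all_reals all_analysis.
From mathcomp Require Import ring lra.
Import Order.TTheory GRing.Theory Num.Theory.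
Import numFieldNormedType.Exports.

(** The first claim is a matter of distances: if lam i is the vertex nearest
    to z, the other factors of f(z) are bounded below by half the minimal gap
    between vertices, so that dist z X <= C |f(z)| ([dist_le_prod]).

    For the second claim, a normal operator A whose spectrum is the finite set
    X satisfies prod_i (A - lam i) = 0 ([prod_shift_eq0]), so that each basis
    vector splits as e_n = sum_i u_n^i with u_n^i in the eigenspace of lam i
    ([eigen_decomposition]), and these eigenspaces are orthogonal
    ([eigen_orthogonal]). With t_i(n) = |u_n^i|^2 this gives
    sum_i t_i(n) = 1 and d_n = sum_i t_i(n) lam i ([diagonal_weights]).

    Let x_n = lam (b n) approximate d with sum |d_n - x_n| finite. As lam (b n)
    is not in the convex hull of the other vertices, |d_n - x_n| is at least a
    fixed multiple of w_n = 1 - t_(b n)(n) ([vertex_gap]), whence sum w_n is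
    finite. Moreover
      sum_n (d_n - x_n) = sum_i lam i * L_i,
      L_i = sum_n (t_i(n) - [b n = i]),
    and sum_i L_i = 0 because both sum_i t_i(n) and sum_i [b n = i] are 1. It
    remains to see that each L_i is an integer, which is a form of Kadison's
    integrality theorem for the diagonals of projections. Fix i. The partial
    sum of the t_i(n) over n < m is the trace of the compression
    G = (<u_k^i, e_l>)_(k, l < m) of the spectral projection, a Hermitian matrix
    with 0 <= G <= 1. The trace of G - G^2 is the sum of the |<u_k^i, e_l>|^2 over
    k < m <= l (Parseval), which by the inequality of Bessel is at most the
    tail over n >= m of the series of the t_i(n) - t_i(n)^2 <= w_n
    ([gram_defect]). For large m the eigenvalues of G therefore lie close to 0
    or 1, even in total, and the trace of G is close to an integer
    ([gram_trace]); so L_i is a limit of integers ([series_to_int]).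

    The relation prod_i (A - lam i) = 0 is obtained from approximate
    eigenvectors. A bounded self-adjoint operator S has an approximate
    eigenvalue, even when one looks only at vectors that are already
    approximate eigenvectors for operators commuting with S
    ([joint_eig_extend], [joint_eig_extend_neq0]). If T = prod_i (A - lam i)
    were not 0, this would apply to T^* T with a nonzero eigenvalue, and then
    to the real and imaginary parts of A. The resulting vectors are approximate
    eigenvectors of A for some z, so z is in the spectrum, hence is some
    lam i; but then T is small on them, contradicting that T^* T is not. *)

Set Implicit Arguments.
Unset Strict Implicit.
Unset Printing Implicit Defensive.

Local Open Scope classical_set_scope.
Local Open Scope ring_scope.
Local Open Scope complex_scope.

(** * Moduli, norms and approximate eigenvectors *)

Section Modulus.
Variable R : realType.
Implicit Types z w : R[i].

Lemma modulus0 : modulus (0 : R[i]) = 0.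
Proof. by rewrite /modulus normr0. Qed.

Lemma modulusM z w : modulus (z * w) = modulus z * modulus w.
Proof. by apply: complexI; rewrite -modulusE normrM rmorphM /= -!modulusE. Qed.

Lemma modulusR (r : R) : modulus r%:C = `|r|.
Proof. by rewrite /modulus normc_def /= expr0n addr0 sqrtr_sqr. Qed.

Lemma modulus_sum (I : Type) (s : seq I) (P : pred I) (F : I -> R[i]) :
  modulus (\sum_(i <- s | P i) F i) <= \sum_(i <- s | P i) modulus (F i).
Proof.
elim/big_rec2: _ => [|i y z _ le_zy]; first by rewrite modulus0.
by apply: le_trans (modulusD_le _ _) _; rewrite lerD2l.
Qed.

Lemma modulus_prod (I : Type) (s : seq I) (P : pred I) (F : I -> R[i]) :
  modulus (\prod_(i <- s | P i) F i) = \prod_(i <- s | P i) modulus (F i).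
Proof.
elim/big_rec2: _ => [|i y z _ <-]; last by rewrite modulusM.
by rewrite /modulus normr1.
Qed.

End Modulus.

Section Ops.
Variables (R : realType) (H : completeNormedModType R[i]).
Variable ip : {dot H for Num.conj}.
Hypothesis hilbert : norm_of_dot ip.
Implicit Types x y : H.

(** The norm of H takes its values in the complex numbers; suprema and
    estimates are taken in R. *)
Definition nm x : R := complex.Re `|x|.

Lemma nmE x : `|x| = (nm x)%:C.
Proof. by rewrite RRe_real // ger0_real. Qed.

Lemma nm_ge0 x : 0 <= nm x.
Proof. by rewrite -ler0c -nmE. Qed.

Lemma nmD x y : nm (x + y) <= nm x + nm y.
Proof. by rewrite -lecR rmorphD /= -!nmE ler_normD. Qed.

Lemma nmZ (c : R[i]) x : nm (c *: x) = modulus c * nm x.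
Proof. by apply: complexI; rewrite rmorphM /= -!nmE -modulusE normrZ. Qed.

Lemma nmN x : nm (- x) = nm x.
Proof. by rewrite /nm normrN. Qed.

Lemma nm_gt0 x : (0 < nm x) = (x != 0).
Proof. by rewrite -normr_gt0 nmE -ltcR. Qed.

Lemma ip_nm x : ip x x = (nm x ^+ 2)%:C.
Proof. by rewrite -hilbert nmE rmorphXn. Qed.

Lemma ipC x y : ip x y = (ip y x)^*%C.
Proof. by rewrite hermC expr0 mul1r. Qed.

Lemma nm0 : nm (0 : H) = 0.
Proof. by rewrite /nm normr0. Qed.

Lemma nm_eq0 x : (nm x == 0) = (x == 0).
Proof.
apply/idP/idP => [|/eqP->]; last by rewrite nm0.
by apply: contraLR; rewrite -nm_gt0 lt0r => /andP[].
Qed.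

Lemma nmB_sqr (r : R) x y :
  nm (x - r%:C *: y) ^+ 2 =
  nm x ^+ 2 - 2 * r * complex.Re (ip x y) + r ^+ 2 * nm y ^+ 2.
Proof.
have conj_r : Num.conj r%:C = r%:C by exact: conjc_real.
have expand : ip (x - r%:C *: y) (x - r%:C *: y) =
    ip x x - r%:C * ip x y - r%:C * (ip y x - r%:C * ip y y).
  by rewrite linearBl !linearBr linearZl_LR !linearZr_LR /= linearZl_LR /= conj_r.
apply: complexI; rewrite -ip_nm expand (ipC y x) !ip_nm; case: (ip x y) => a b /=.
rewrite mulrA; simpc; apply/eqP; rewrite eq_complex /=.
by apply/andP; split; apply/eqP; ring.
Qed.

Implicit Type L : set ({linear H -> H} * R[i]).

(** A family of eigenvalue equations is given by pairs (operator, scalar); the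
    condition is homogeneous in x to dispense with normalization. *)
Definition near_eig (L : set ({linear H -> H} * R[i])) (eps : R) x :=
  forall p, L p -> nm (p.1 x - p.2 *: x) <= eps * nm x.

Definition joint_eig L := forall eps : R, 0 < eps ->
  exists2 x, x != 0 & near_eig L eps x.

Lemma near_eigW L eps eps' x : eps <= eps' -> near_eig L eps x -> near_eig L eps' x.
Proof.
by move=> le_e nx p /nx /le_trans; apply; rewrite ler_wpM2r ?nm_ge0.
Qed.

(** Let c be the largest norm of S on the approximate eigenvectors of L. On a
    unit approximate eigenvector x where |S x| is nearly c, S (S x) has norm at
    most about c^2, because S x again is an approximate eigenvector of L;
    expanding |S^2 x - c^2 x|^2, with <S^2 x, x> = |S x|^2, shows that it is
    small. As S^2 - c^2 = (S + c) (S - c), either c is a joint approximate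
    eigenvalue, or the vectors (S - c) x are not small and witness that - c is
    one. The hypothesis with [del] gives c > 0. *)
Lemma joint_eig_extend_neq0 L (S : {linear H -> H}) (M del : R) :
  (forall x y, ip (S x) y = ip x (S y)) ->
  0 < M -> (forall x, nm (S x) <= M * nm x) ->
  (forall p, L p -> forall x, p.1 (S x) = S (p.1 x)) ->
  0 < del ->
  (forall eps : R, 0 < eps -> exists x, [/\ x != 0, near_eig L eps x
     & del * nm x <= nm (S x)]) ->
  exists2 s : R, s != 0 & joint_eig (L `|` [set (S, s%:C)]).
Proof.
move=> Sadj M_gt0 SM LS del_gt0 Gdel.
pose G : set R := [set r | forall eps : R, 0 < eps -> exists x, [/\ x != 0,
  near_eig L eps x & r * nm x <= nm (S x)]].
have supG : has_sup G.
  split; first by exists del.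
  exists M => r /(_ 1 ltr01)[x [x0 _ /le_trans /(_ (SM x))]].
  by rewrite ler_pM2r ?nm_gt0.
pose c := sup G.
have c_gt0 : 0 < c by apply: lt_le_trans del_gt0 _; apply: ub_le_sup => //; case: supG.
have upG (eta : R) : 0 < eta -> exists2 eps : R, 0 < eps & forall x, near_eig L eps x ->
    nm (S x) <= (c + eta) * nm x.
  move=> eta_gt0; apply: contrapT => noeps.
  suff : c + eta <= c by rewrite gerDl leNgt eta_gt0.
  apply: ub_le_sup; first by case: supG.
  move=> eps eps_gt0; apply: contrapT => nox; apply: noeps; exists eps => // x nx.
  have [->|x0] := eqVneq x 0; first by rewrite linear0 nm0 mulr0.
  by rewrite leNgt; apply/negP => /ltW lt_x; apply: nox; exists x.
(* c + eta fails for some precision, c - eta holds for every precision. *)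
have dnG (eta eps : R) : 0 < eta -> 0 < eps -> exists x, [/\ x != 0, near_eig L eps x
    & (c - eta) * nm x <= nm (S x)].
  move=> eta_gt0 eps_gt0; have [r Gr lt_r] := sup_adherent eta_gt0 supG.
  have [x [x0 nx le_x]] := Gr _ eps_gt0; exists x; split=> //.
  by apply: le_trans le_x; rewrite ler_wpM2r ?nm_ge0 // ltW.
have shift_eig (k : R) x p : L p -> p.1 (S x - k%:C *: x) - p.2 *: (S x - k%:C *: x) =
    S (p.1 x - p.2 *: x) - k%:C *: (p.1 x - p.2 *: x).
  move=> Lp; rewrite !linearB !linearZ /= LS // !scalerA [p.2 * _]mulrC.
  by rewrite addrACA.
have sqG (eps : R) : 0 < eps -> exists x, [/\ x != 0, near_eig L eps x
    & nm (S (S x) - (c ^+ 2)%:C *: x) <= eps * nm x].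
  move=> eps_gt0.
  (* 19 = 15 + 4: (c + eta)^4 <= c^4 + 15 c^3 eta and
     - 2 c^2 (c - eta)^2 <= - 2 c^4 + 4 c^3 eta, as eta <= c. *)
  pose eta := Num.min (c / 2) (eps ^+ 2 / (19 * c ^+ 3)).
  have eta_gt0 : 0 < eta.
    by rewrite lt_min divr_gt0 //= divr_gt0 ?exprn_gt0 // mulr_gt0 // exprn_gt0.
  have eta_c : eta <= c / 2 by rewrite ge_min lexx.
  have eta_e : 19 * c ^+ 3 * eta <= eps ^+ 2.
    rewrite mulrC -ler_pdivlMr ?mulr_gt0 ?exprn_gt0 //.
    by rewrite ge_min lexx orbT.
  have [eps' eps'_gt0 up'] := upG _ eta_gt0.
  (* S x must be an approximate eigenvector to precision eps': the defect grows
     by M, while |S x| >= c / 2 |x|. *)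
  pose eps1 := Num.min eps (Num.min eps' (eps' * c / (2 * M))).
  have eps1_gt0 : 0 < eps1 by rewrite !lt_min eps_gt0 eps'_gt0 /= divr_gt0 ?mulr_gt0.
  have [x [x0 nx le_x]] := dnG _ _ eta_gt0 eps1_gt0.
  exists x; split=> //; first by apply: near_eigW nx; rewrite ge_min lexx.
  have nx' : nm (S x) <= (c + eta) * nm x.
    by apply/up'/near_eigW/nx; rewrite !ge_min lexx orbT.
  have x_gt0 : 0 < nm x by rewrite nm_gt0.
  have nSSx : nm (S (S x)) <= (c + eta) * nm (S x).
    apply: up' => p Lp.
    have := shift_eig 0 x p Lp; rewrite !scale0r !subr0 => ->.
    apply: le_trans (SM _) _.
    have /(ler_wpM2l (ltW M_gt0)) := nx p Lp; move/le_trans; apply.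
    have : M * eps1 <= eps' * (c / 2).
      have : eps1 <= eps' * c / (2 * M) by rewrite !ge_min lexx !orbT.
      rewrite ler_pdivlMr ?mulr_gt0 //; lra.
    move/(ler_wpM2r (nm_ge0 x)); rewrite -[leLHS]mulrA => /le_trans; apply.
    rewrite -mulrA ler_pM2l //; apply: le_trans le_x.
    by rewrite ler_pM2r //; lra.
  rewrite -ler_sqr ?nnegrE ?nm_ge0 ?mulr_ge0 ?nm_ge0 ?(ltW eps_gt0) //.
  rewrite nmB_sqr Sadj ip_nm /=.
  have {}nSSx : nm (S (S x)) <= (c + eta) ^+ 2 * nm x.
    by apply: le_trans nSSx _; rewrite expr2 -mulrA ler_pM2l //; lra.
  have sq1 : nm (S (S x)) ^+ 2 <= (c + eta) ^+ 4 * nm x ^+ 2.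
    have -> : (c + eta) ^+ 4 = ((c + eta) ^+ 2) ^+ 2 by rewrite -exprM.
    rewrite -exprMn.
    by rewrite ler_sqr ?nnegrE ?mulr_ge0 ?exprn_ge0 ?nm_ge0 //; lra.
  have sq2 : (c - eta) ^+ 2 * nm x ^+ 2 <= nm (S x) ^+ 2.
    by rewrite -exprMn ler_sqr ?nnegrE ?mulr_ge0 ?nm_ge0 //; lra.
  have poly : (c + eta) ^+ 4 - 2 * c ^+ 2 * (c - eta) ^+ 2 + (c ^+ 2) ^+ 2 <= eps ^+ 2.
    apply: le_trans eta_e.
    have e1 : eta ^+ 2 <= c * eta by rewrite expr2 ler_pM2r //; lra.
    have e2 : c ^+ 2 * eta ^+ 2 <= c ^+ 3 * eta.
      by rewrite exprS -mulrA mulrCA [c * _]mulrC mulrA; nra.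
    have e3 : c * eta ^+ 3 <= c ^+ 3 * eta.
      have := ler_wpM2r (ltW eta_gt0) e2; have := e2; nra.
    have e4 : eta ^+ 4 <= c ^+ 3 * eta.
      have : eta * eta ^+ 3 <= c * eta ^+ 3 by rewrite ler_wpM2r ?exprn_ge0 //; lra.
      by rewrite -exprS; lra.
    have -> : (c + eta) ^+ 4 - 2 * c ^+ 2 * (c - eta) ^+ 2 + (c ^+ 2) ^+ 2 =
      8 * (c ^+ 3 * eta) + 4 * (c ^+ 2 * eta ^+ 2) + 4 * (c * eta ^+ 3) + eta ^+ 4 by ring.
    by have := mulr_gt0 (exprn_gt0 3 c_gt0) eta_gt0; lra.
  have := ler_wpM2r (exprn_ge0 2 (nm_ge0 x)) poly.
  have := ler_wpM2l (exprn_ge0 2 (ltW c_gt0)) sq2.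
  rewrite exprMn; lra.
have [cJ|ncJ] := pselect (joint_eig (L `|` [set (S, c%:C)])).
  by exists c => //; rewrite gt_eqF.
exists (- c); first by rewrite oppr_eq0 gt_eqF.
have [d0 d0_gt0 d0P] : exists2 d0 : R, 0 < d0 & forall x, x != 0 -> near_eig L d0 x ->
    d0 * nm x < nm (S x - c%:C *: x).
  apply: contrapT => nod; apply: ncJ => eps eps_gt0.
  apply: contrapT => nox; apply: nod; exists eps => // x x0 nx.
  rewrite ltNge; apply/negP => le_x; apply: nox; exists x => // p [/nx//|->//].
move=> eps eps_gt0.
pose eps1 := Num.min d0 (Num.min (eps * d0) (eps * d0 / (M + c))).
have Mc_gt0 : 0 < M + c by rewrite addr_gt0.
have eps1_gt0 : 0 < eps1 by rewrite !lt_min d0_gt0 /= mulr_gt0 //= divr_gt0 // mulr_gt0.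
have [x [x0 nx sqx]] := sqG _ eps1_gt0.
have x_gt0 : 0 < nm x by rewrite nm_gt0.
have lt_y : d0 * nm x < nm (S x - c%:C *: x).
  by apply: d0P => //; apply: near_eigW nx; rewrite ge_min lexx.
exists (S x - c%:C *: x).
  by rewrite -nm_gt0; apply: le_lt_trans lt_y; rewrite mulr_ge0 // ltW.
have le_ed : eps * d0 * nm x <= eps * nm (S x - c%:C *: x).
  by rewrite -mulrA ler_pM2l // ltW.
move=> p [Lp|->] /=.
  rewrite shift_eig //; apply: le_trans le_ed.
  apply: le_trans (nmD _ _) _; rewrite nmN nmZ modulusR gtr0_norm //.
  apply: (@le_trans _ _ ((M + c) * nm (p.1 x - p.2 *: x))).
    by rewrite mulrDl lerD2r.
  have /(ler_wpM2l (ltW Mc_gt0)) := nx p Lp; move/le_trans; apply.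
  rewrite mulrA ler_pM2r // mulrC -ler_pdivlMr //.
  by rewrite !ge_min lexx !orbT.
apply: le_trans le_ed.
have -> : S (S x - c%:C *: x) - (- c)%:C *: (S x - c%:C *: x) = S (S x) - (c ^+ 2)%:C *: x.
  rewrite linearB linearZ /= rmorphN scaleNr opprK scalerBr scalerA -rmorphM /= -expr2.
  by rewrite addrA subrK.
apply: le_trans sqx _; rewrite ler_pM2r //.
by rewrite !ge_min lexx !orbT.
Qed.

(** When S is arbitrarily small on the approximate eigenvectors of L, 0 is the
    joint approximate eigenvalue. *)
Lemma joint_eig_extend L (S : {linear H -> H}) (M : R) :
  (forall x y, ip (S x) y = ip x (S y)) ->
  0 < M -> (forall x, nm (S x) <= M * nm x) ->
  (forall p, L p -> forall x, p.1 (S x) = S (p.1 x)) ->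
  joint_eig L ->
  exists s : R, joint_eig (L `|` [set (S, s%:C)]).
Proof.
move=> Sadj M_gt0 SM LS Leig.
have [[del del_gt0 Gdel]|nodel] := pselect (exists2 del : R, 0 < del &
  forall eps : R, 0 < eps -> exists x, [/\ x != 0, near_eig L eps x
     & del * nm x <= nm (S x)]).
  by have [s _ sP] := joint_eig_extend_neq0 Sadj M_gt0 SM LS del_gt0 Gdel; exists s.
exists 0 => eps eps_gt0; apply: contrapT => nox; apply: nodel; exists eps => //.
move=> eps' eps'_gt0.
have [|x x0 nx] := Leig (Num.min eps eps'); first by rewrite lt_min eps_gt0.
exists x; split=> //; first by apply: near_eigW nx; rewrite ge_min lexx orbT.
rewrite leNgt; apply/negP => lt_x; apply: nox; exists x => // p [Lp|-> /=].
  by apply: near_eigW nx _ Lp; rewrite ge_min lexx.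
by rewrite scale0r subr0 ltW.
Qed.

End Ops.

(** * Normal operators with finite spectrum *)

Section Spectral.
Variables (R : realType) (H : completeNormedModType R[i]).
Variable ip : {dot H for Num.conj}.
Hypothesis hilbert : norm_of_dot ip.
Implicit Types (x y : H) (A B : {linear H -> H}) (s : seq R[i]).

Fixpoint prod_shift A s : {linear H -> H} :=
  if s is l :: s' then (prod_shift A s' \o (A \- l \*: idfun))%FUN else idfun.

Lemma prod_shift_cons A l s x :
  prod_shift A (l :: s) x = prod_shift A s (A x - l *: x).
Proof. by []. Qed.

Lemma bounded_opP A : bounded_op A ->
  exists2 M : R, 0 < M & forall x, nm (A x) <= M * nm x.
Proof.
case=> M AM; exists (modulus M + 1); first by rewrite ltr_wpDl ?modulus_ge0.
move=> x; have AMx := AM x; have M_ge0 : 0 <= M * `|x| by apply: le_trans AMx.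
rewrite mulrDl mul1r -[leLHS]addr0 lerD ?nm_ge0 //.
rewrite -lecR rmorphM /= -modulusE -!nmE; apply: le_trans AMx _.
by rewrite -[leLHS]ger0_norm // normrM normr_id.
Qed.

Lemma prod_shift_comm A (C : {linear H -> H}) s x : (forall x, A (C x) = C (A x)) ->
  prod_shift A s (C x) = C (prod_shift A s x).
Proof.
move=> AC; elim: s x => [//|l s IHs] x.
by rewrite !prod_shift_cons -IHs AC !linearB !linearZ.
Qed.

Lemma prod_shift_adj A B s x y : is_adjoint ip A B ->
  ip (prod_shift A s x) y = ip x (prod_shift B [seq Num.conj l | l <- s] y).
Proof.
move=> AB; elim: s x y => [//|l s IHs] x y.
rewrite map_cons !prod_shift_cons IHs linearBl linearZl_LR /= AB.
rewrite -(prod_shift_comm (C := B)) // [in RHS]linearB [X in _ = ip x (_ - X)]linearZ.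
by rewrite [in RHS]linearBr [X in _ = _ - X]linearZr_LR /= conjCK.
Qed.

Lemma nm_shift A (M : R) l x : (forall x, nm (A x) <= M * nm x) ->
  nm (A x - l *: x) <= (M + modulus l) * nm x.
Proof.
by move=> AM; apply: le_trans (nmD _ _) _; rewrite nmN nmZ mulrDl lerD2r.
Qed.

Lemma prod_shift_bounded A s (M : R) : 0 < M -> (forall x, nm (A x) <= M * nm x) ->
  exists2 M' : R, 0 < M' & forall x, nm (prod_shift A s x) <= M' * nm x.
Proof.
move=> M_gt0 AM; elim: s => [|l s [M' M'_gt0 IHs]].
  by exists 1 => // x; rewrite mul1r.
exists (M' * (M + modulus l)); first by rewrite mulr_gt0 // ltr_wpDr ?modulus_ge0.
move=> x; rewrite prod_shift_cons -mulrA; apply: le_trans (IHs _) _.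
by rewrite ler_pM2l // nm_shift.
Qed.

(** The shifts commute, so that the one by l can be applied first. *)
Lemma prod_shift_root A s l (M : R) : 0 < M -> (forall x, nm (A x) <= M * nm x) ->
  l \in s ->
  exists2 M' : R, 0 < M' & forall x, nm (prod_shift A s x) <= M' * nm (A x - l *: x).
Proof.
move=> M_gt0 AM; elim: s => [//|k s IHs]; rewrite in_cons.
have [<- _|_ /= /IHs [M' M'_gt0 M'P]] := eqVneq l k.
  have [M' M'_gt0 M'P] := prod_shift_bounded s M_gt0 AM; exists M' => // x.
  exact: M'P.
exists (M' * (M + modulus k)); first by rewrite mulr_gt0 // ltr_wpDr ?modulus_ge0.
move=> x; apply: le_trans (M'P _) _.
rewrite -mulrA ler_pM2l //.
have -> : A (A x - k *: x) - l *: (A x - k *: x) = A (A x - l *: x) - k *: (A x - l *: x).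
  by rewrite !linearB !linearZ /= !scalerA [l * _]mulrC addrACA.
exact: nm_shift.
Qed.

Lemma adjoint_sym A B : is_adjoint ip A B -> is_adjoint ip B A.
Proof. by move=> AB x y; rewrite (ipC _ (B x)) (ipC _ x) AB. Qed.

(** If T = prod (A - l) were not 0, K = T^* T would be a nonzero self-adjoint
    operator commuting with A + A^* and i (A - A^* ). Joint approximate
    eigenvectors of the three operators, with k != 0 for K, are approximate
    eigenvectors of A for a point z, which hence belongs to the spectrum; then
    T is small on them, and K is not. *)
Lemma prod_shift_eq0 A s : bounded_op A -> normal_op ip A ->
  (forall z, spectrum A z -> z \in s) -> forall x, prod_shift A s x = 0.
Proof.
move=> /bounded_opP[M M_gt0 AM] [B [/bounded_opP[M' M'_gt0 BM] AB comAB]] spA x0.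
have BA := adjoint_sym AB.
apply: contrapT => /eqP Tx0.
pose s' := [seq Num.conj l | l <- s].
pose T := prod_shift A s; pose T' := prod_shift B s'.
have TT' x y : ip (T x) y = ip x (T' y) by exact: prod_shift_adj.
have T'T x y : ip (T' x) y = ip x (T y) by exact: (@adjoint_sym T T').
pose K : {linear H -> H} := (T' \o T)%FUN.
pose S1 : {linear H -> H} := (A \+ B)%FUN.
pose S2 : {linear H -> H} := ('i%C \*: (A \- B))%FUN.
have S1E x : S1 x = A x + B x by [].
have S2E x : S2 x = 'i%C *: (A x - B x) by [].
have KE x : K x = T' (T x) by [].
have [MT MT_gt0 TM] := prod_shift_bounded s M_gt0 AM.
have [MT' MT'_gt0 T'M] := prod_shift_bounded s' M'_gt0 BM.
have KM x : nm (K x) <= MT' * nm (T x) by exact: T'M.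
have MM_gt0 : 0 < M + M' by rewrite addr_gt0.
have S1M x : nm (S1 x) <= (M + M') * nm x.
  by apply: le_trans (nmD _ _) _; rewrite mulrDl lerD.
have S2M x : nm (S2 x) <= (M + M') * nm x.
  rewrite S2E nmZ /modulus norm_imaginary mul1r.
  by apply: le_trans (nmD _ _) _; rewrite nmN mulrDl lerD.
have [k k0 eigK] : exists2 k : R, k != 0 & joint_eig (set0 `|` [set (K, k%:C)]).
  have Kx0 : 0 < nm (K x0).
    rewrite nm_gt0; apply/eqP => K0; move/eqP : Tx0; apply; apply/eqP.
    by rewrite -/T -nm_eq0 -sqrf_eq0 -(inj_eq (@complexI R)) -(ip_nm hilbert) TT' -KE K0 linear0r.
  have x0_gt0 : 0 < nm x0.
    by rewrite nm_gt0; apply: contraTneq Kx0 => ->; rewrite linear0 nm0 ltxx.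
  apply: (joint_eig_extend_neq0 hilbert (M := MT' * MT) (del := nm (K x0) / nm x0)) => //.
  - by move=> x y; rewrite !KE T'T TT'.
  - exact: mulr_gt0.
  - by move=> x; apply: le_trans (KM x) _; rewrite -mulrA ler_pM2l.
  - exact: divr_gt0.
  - move=> eps eps_gt0; exists x0; split=> //; first by rewrite -nm_gt0.
    by rewrite divfK ?gt_eqF.
have KA x : K (A x) = A (K x).
  by rewrite !KE [T (_ x)]prod_shift_comm // [LHS]prod_shift_comm.
have KB x : K (B x) = B (K x).
  by rewrite !KE [T (_ x)]prod_shift_comm // [LHS]prod_shift_comm.
have [b eigKb] : exists b : R, joint_eig (set0 `|` [set (K, k%:C)] `|` [set (S1, b%:C)]).
  apply: (joint_eig_extend hilbert (M := M + M')) => //.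
    by move=> x y; rewrite !S1E linearDl linearDr /= AB BA addrC.
  move=> _ [//|->] x; rewrite -[RHS]/(A (K x) + B (K x)) -KA -KB; exact: linearD.
have [c eigKbc] : exists c : R, joint_eig (set0 `|` [set (K, k%:C)] `|`
   [set (S1, b%:C)] `|` [set (S2, c%:C)]).
  apply: (joint_eig_extend hilbert (M := M + M')) => //.
    move=> x y; rewrite !S2E linearZl_LR linearZr_LR linearBl linearBr /= AB BA.
    have -> : Num.conj ('i%C : R[i]) = - 'i%C by apply/eqP; rewrite eq_complex /= oppr0 !eqxx.
    by rewrite mulNr -mulrN linearBr /= opprB mulrBr.
  move=> _ [[//|->]|->] x; rewrite -[S2 x]/('i%C *: (A x - B x)) /fst.
    rewrite -[RHS]/('i%C *: (A (K x) - B (K x))) -KA -KB -linearB; exact: linearZ.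
  rewrite -[LHS]/(A ('i%C *: (A x - B x)) + B ('i%C *: (A x - B x))).
  rewrite -[RHS]/('i%C *: (A (A x + B x) - B (A x + B x))).
  rewrite !linearZ -[LHS]scalerDr; congr (_ *: _).
  by rewrite !linearB !linearD !comAB !addrA subrK addrK.
(* 2 A = S1 - i S2. *)
pose z : R[i] := 2^-1 * (b%:C - 'i%C * c%:C).
have Az (eps : R) x : nm (S1 x - b%:C *: x) <= eps * nm x ->
    nm (S2 x - c%:C *: x) <= eps * nm x -> nm (A x - z *: x) <= eps * nm x.
  move=> le1 le2.
  have -> : A x - z *: x = 2^-1 *: ((S1 x - b%:C *: x) - 'i%C *: (S2 x - c%:C *: x)).
    have -> : 'i%C *: (S2 x - c%:C *: x) = B x - A x - ('i%C * c%:C) *: x.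
      by rewrite S2E scalerBr !scalerA -expr2 sqr_i scaleN1r opprB.
    have -> : S1 x - b%:C *: x - (B x - A x - ('i%C * c%:C) *: x) = 2 *: (A x - z *: x).
      rewrite scalerBr scalerA /z mulrA divff // mul1r scalerBl scaler_nat S1E.
      rewrite mulr2n !opprB -!addrA; congr (_ + _).
      by rewrite addrC -!addrA addNr addr0 addrA addrC [- _ + _]addrC.
    by rewrite scalerA mulVf // scale1r.
  have m2 : modulus (2^-1 : R[i]) = 2^-1.
    have -> : (2^-1 : R[i]) = (2^-1 : R)%:C by rewrite fmorphV rmorph_nat.
    by rewrite modulusR ger0_norm.
  rewrite nmZ m2; have := nmD (S1 x - b%:C *: x) (- ('i%C *: (S2 x - c%:C *: x))).
  rewrite nmN nmZ /modulus norm_imaginary mul1r; lra.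
(* A bounded inverse C of A - z would give |x| <= MC |A x - z x|. *)
have zs : z \in s.
  apply: spA => -[C [/bounded_opP[MC MC_gt0 CM] Cinv _]].
  have [|x xn0 nx] := eigKbc (MC^-1 / 2); first by rewrite divr_gt0 ?invr_gt0.
  have {}nx : nm (A x - z *: x) <= MC^-1 / 2 * nm x.
    apply: Az; first by apply: (nx (S1, b%:C)); left; right.
    by apply: (nx (S2, c%:C)); right.
  have := CM (A x - z *: x); rewrite Cinv => nx'.
  have := le_trans nx' (ler_wpM2l (ltW MC_gt0) nx).
  rewrite !mulrA mulfV ?gt_eqF // mul1r -subr_ge0 -[X in _ - X]mul1r -mulrBl.
  by rewrite pmulr_lge0 ?nm_gt0 //; lra.
have [Mz Mz_gt0 MzP] := prod_shift_root M_gt0 AM zs.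
pose eps := `|k| / (2 * (1 + MT' * Mz)).
have MM1 : 0 < 1 + MT' * Mz by rewrite addr_gt0 // mulr_gt0.
have k_gt0 : 0 < `|k| by rewrite normr_gt0.
have eps_gt0 : 0 < eps by rewrite divr_gt0 // mulr_gt0.
have [x xn0 nx] := eigKbc eps eps_gt0.
have nKx : nm (K x - k%:C *: x) <= eps * nm x by apply: (nx (K, k%:C)); left; left; right.
have nAx : nm (A x - z *: x) <= eps * nm x.
  apply: Az; first by apply: (nx (S1, b%:C)); left; right.
  by apply: (nx (S2, c%:C)); right.
have nTx := le_trans (MzP x) (ler_wpM2l (ltW Mz_gt0) nAx).
have {}nTx := le_trans (KM x) (ler_wpM2l (ltW MT'_gt0) nTx).
have : `|k| * nm x <= nm (K x) + nm (K x - k%:C *: x).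
  rewrite -modulusR -nmZ -[X in nm X <= _](subKr (K x)); apply: le_trans (nmD _ _) _.
  by rewrite nmN.
have epsE : eps * (1 + MT' * Mz) = `|k| / 2.
  by rewrite /eps; field; rewrite gt_eqF //= gt_eqF.
have x_gt0 : 0 < nm x by rewrite nm_gt0.
have := mulr_gt0 k_gt0 x_gt0.
have : (eps * (1 + MT' * Mz)) * nm x = `|k| / 2 * nm x by rewrite epsE.
lra.
Qed.

End Spectral.

(** * Orthogonal decomposition into eigenvectors *)

Section EigenDecomposition.
Variables (R : realType) (H : completeNormedModType R[i]).
Variable ip : {dot H for Num.conj}.
Hypothesis hilbert : norm_of_dot ip.
Implicit Types (x y : H) (A B : {linear H -> H}).

(** Lagrange interpolation, by induction on r: (A - lam i) x splits into the z j,
    and dividing z j by lam j - lam i splits x up to a vector killed by A - lam i. *)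
Lemma eigen_decomposition (I : eqType) (lam : I -> R[i]) (r : seq I) A x :
  injective lam -> uniq r -> prod_shift A [seq lam i | i <- r] x = 0 ->
  exists2 y : I -> H, (forall i, A (y i) = lam i *: y i) & x = \sum_(i <- r) y i.
Proof.
move=> lam_inj; elim: r x => [|i r IHr] x.
  move=> _ x0; exists (fun=> 0); last by rewrite big_nil; exact: x0.
  by move=> i; rewrite linear0 scaler0.
rewrite cons_uniq => /andP[ir ur]; rewrite map_cons prod_shift_cons => /(IHr _ ur)[z Az zE].
pose w j := (lam j - lam i)^-1 *: z j.
have Aw j : A (w j) = lam j *: w j by rewrite linearZ Az /= !scalerA mulrC.
have sum_w : \sum_(j <- r) (A (w j) - lam i *: w j) = A x - lam i *: x.
  rewrite zE big_seq [RHS]big_seq; apply: eq_bigr => j jr.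
  rewrite Aw -scalerBl scalerA mulfV ?scale1r // subr_eq0 (inj_eq lam_inj).
  by apply: contraNneq ir => <-.
exists (fun j => if j == i then x - \sum_(j <- r) w j else w j) => [j|].
  case: eqP => [->|_]; last exact: Aw.
  apply/eqP; rewrite -subr_eq0 linearB scalerBr linear_sum scaler_sumr /=.
  rewrite opprB [X in _ + X]addrC addrACA -sum_w sumrB addrACA subrr add0r.
  by rewrite addNr.
rewrite big_cons eqxx [X in _ + X](_ : _ = \sum_(j <- r) w j) ?subrK //.
rewrite big_seq [RHS]big_seq; apply: eq_bigr => j jr.
by case: eqP jr => // ->; rewrite (negPf ir).
Qed.

(** Both squared norms are the value at x of the same operator, since A - l
    commutes with its adjoint. *)
Lemma nm_adjoint_shift A B l x : is_adjoint ip A B -> (forall x, A (B x) = B (A x)) ->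
  nm (B x - Num.conj l *: x) = nm (A x - l *: x).
Proof.
move=> AB comAB; have BA := adjoint_sym AB.
apply/eqP; rewrite -(@eqrXn2 _ 2) ?nm_ge0 // -(inj_eq (@complexI R)) -!(ip_nm hilbert).
apply/eqP; rewrite !linearBl !linearBr !linearZl_LR !linearZr_LR /=.
rewrite !BA !AB conjCK comAB.
rewrite -[l *: _]/(l * _) -[Num.conj l *: _]/(Num.conj l * _).
ring.
Qed.

Lemma eigen_orthogonal A B l m x y : is_adjoint ip A B -> (forall x, A (B x) = B (A x)) ->
  A x = l *: x -> A y = m *: y -> l != m -> ip x y = 0.
Proof.
move=> AB comAB Ax Ay lm.
have By : B y = Num.conj m *: y.
  by apply/eqP; rewrite -subr_eq0 -nm_eq0 (nm_adjoint_shift _ _ AB comAB) Ay subrr nm0.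
have /eqP : l * ip x y = m * ip x y.
  have -> : l * ip x y = ip (A x) y by rewrite Ax linearZl_LR.
  by rewrite AB By linearZr_LR /= conjCK.
by rewrite -subr_eq0 -mulrBl mulf_eq0 subr_eq0 (negPf lm) => /eqP.
Qed.

End EigenDecomposition.

(** * Hermitian matrices with nearly integral trace *)

Section Trace.
Variable (R : realType).
Local Open Scope sesquilinear_scope.
Lemma near_bit (g : R) : 0 <= g -> g <= 1 ->
  exists b : bool, `|g - b%:R| <= 2 * (g - g ^+ 2).
Proof.
move=> g_ge0 g_le1; have [le_g|lt_g] := leP g 2^-1.
- by exists false; rewrite subr0 ger0_norm //; nra.
- by exists true; rewrite distrC ger0_norm ?subr_ge0 //=; nra.
Qed.

(** In an orthonormal eigenbasis, the defect tr G - tr G^2 is the sum of the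
    g (1 - g) over the eigenvalues g, each of which bounds half the distance of
    g to 0 or 1. *)
Lemma trace_near_nat n (G : 'M[R[i]]_n) : G \is hermsymmx ->
  (forall v : 'rV_n, 0 <= (v *m G *m v ^t*) 0 0 <= (v *m v ^t*) 0 0) ->
  exists k : nat,
    `|complex.Re (\tr G) - k%:R| <= 2 * (complex.Re (\tr G) - complex.Re (\tr (G *m G))).
Proof.
move=> /hermitian_normalmx/orthomx_spectralP; set P := spectralmx G; set D := spectral_diag G.
have Pu : P \is unitarymx := spectral_unitarymx G.
have Punit : P \in unitmx := spectral_unit G.
move=> GE Gpos.
have trG : \tr G = \sum_i D 0 i.
  by rewrite GE -mulmxA mxtrace_mulC mulmxK // mxtrace_diag.
have trGG : \tr (G *m G) = \sum_i D 0 i ^+ 2.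
  rewrite {1}GE {1}GE !mulmxA mulmxK // -!mulmxA mxtrace_mulC !mulmxA mulmxK //.
  rewrite mulmx_diag mxtrace_diag; apply: eq_bigr => i _.
  by rewrite mxE expr2.
have D01 i : 0 <= D 0 i <= 1.
  have := Gpos (row i P).
  have PP : P *m P ^t* = 1%:M by apply/unitarymxP.
  have rowE (Q : 'M[R[i]]_n) : (row i P *m Q *m (row i P) ^t*) 0 0 = (P *m Q *m P ^t*) i i.
    rewrite tr_row map_col -row_mul -row_mul !mxE; apply: eq_bigr => j _.
    by rewrite !mxE.
  have := rowE 1%:M; rewrite !mulmx1 PP => ->; rewrite [1%:M i i]mxE eqxx.
  rewrite rowE GE invmx_unitary // !mulmxA PP mul1mx -mulmxA PP mulmx1 !mxE eqxx.
  by rewrite mulr1n.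
pose g i := complex.Re (D 0 i).
have Dg i : D 0 i = (g i)%:C.
  by rewrite RRe_real // ger0_real //; case/andP: (D01 i).
have /(_ _)/cid-/all_sig[b bP] : forall i, exists b : bool, `|g i - b%:R| <= 2 * (g i - g i ^+ 2).
  by move=> i; have /andP[] := D01 i; rewrite Dg !lecR; exact: near_bit.
exists (\sum_i b i)%N; rewrite trG trGG natr_sum !raddf_sum /=.
rewrite -!big_split mulr_sumr /=; apply: le_trans (ler_norm_sum _ _ _) _; apply: ler_sum => i _.
by rewrite Dg -rmorphXn /=.
Qed.

End Trace.

(** * Bessel and Parseval *)

Section Bases.
Variables (R : realType) (H : completeNormedModType R[i]).
Variable ip : {dot H for Num.conj}.
Hypothesis hilbert : norm_of_dot ip.
Implicit Types (x y u v w : H).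

Lemma sqr_modulus (z : R[i]) : (modulus z ^+ 2)%:C = z * Num.conj z.
Proof. by rewrite rmorphXn /= -modulusE normCK. Qed.

Lemma modulus_ipC x y : modulus (ip x y) = modulus (ip y x).
Proof. by rewrite ipC /modulus normcJ. Qed.

Variable e : nat -> H.
Hypothesis orth : forall i j, ip (e i) (e j) = (i == j)%:R.

(** Pythagoras: the residual of an orthogonal projection. Each new basis vector
    is orthogonal to the previous residual except for its own coefficient. *)
Lemma nm_residual (r : seq nat) x : uniq r ->
  nm (x - \sum_(i <- r) ip x (e i) *: e i) ^+ 2 =
  nm x ^+ 2 - \sum_(i <- r) modulus (ip x (e i)) ^+ 2.
Proof.
elim: r => [|i r IHr]; first by rewrite !big_nil !subr0.
rewrite cons_uniq => /andP[ir /IHr{}IHr]; rewrite !big_cons.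
rewrite [ip x (e i) *: e i + _]addrC [modulus _ ^+ 2 + _]addrC !opprD !addrA -IHr.
set v := x - \sum_(j <- r) _.
have vi : ip v (e i) = ip x (e i).
  rewrite linearBl linear_sumlz /= big_seq big1 ?subr0 // => j jr.
  rewrite linearZl_LR /= orth; case: eqP jr => [->|_ _]; last by rewrite mulr0.
  by rewrite (negPf ir).
rewrite -vi; clearbody v; apply: complexI.
rewrite rmorphB /= -!(ip_nm hilbert) sqr_modulus.
rewrite linearBl !linearBr !linearZl_LR !linearZr_LR /= orth eqxx (ipC _ (e i) v).
rewrite -[(ip v (e i))^*%C]/(Num.conj (ip v (e i))) -[_ *: (_ * _)]/(_ * (_ * _)).
by rewrite mulr1 [X in _ - (_ - X)]mulrC subrr subr0 mulrC.
Qed.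

Lemma bessel (r : seq nat) x : uniq r ->
  \sum_(i <- r) modulus (ip x (e i)) ^+ 2 <= nm x ^+ 2.
Proof. by move=> /nm_residual E; rewrite -subr_ge0 -(E x) exprn_ge0 ?nm_ge0. Qed.

(** A finite combination y of the first n basis vectors equals its projection,
    so the residual of x is that of x - y, which is at most |x - y|. *)
Lemma parseval x (eps : R) : 0 < eps ->
  dense [set x | exists n (c : 'I_n -> R[i]), x = \sum_i c i *: e i] ->
  exists n, forall m, (n <= m)%N ->
   nm x ^+ 2 <= \sum_(0 <= i < m) modulus (ip x (e i)) ^+ 2 + eps.
Proof.
move=> eps_gt0 dns.
pose d := Num.sqrt eps.
have d_gt0 : 0 < d by rewrite sqrtr_gt0.
have [||y [xy [n [c yE]]]] := dns (ball x d%:C).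
- by exists x; apply: ballxx; rewrite ltcR.
- apply: ball_open; rewrite ltcR.
have yP : y = \sum_(0 <= i < n) ip y (e i) *: e i.
  rewrite big_mkord [LHS]yE; apply: eq_bigr => j _; congr (_ *: _).
  rewrite yE linear_sumlz /= (bigD1 j) //= linearZl_LR /= orth eqxx mulr1.
  rewrite big1 ?addr0 // => k /negPf kj; rewrite linearZl_LR /= orth.
  by rewrite -[(_ == _ :> nat)]/(k == j) kj mulr0.
have xy_le : nm (x - y) ^+ 2 <= eps.
  rewrite -(sqr_sqrtr (ltW eps_gt0)) ler_sqr ?nnegrE ?nm_ge0 ?sqrtr_ge0 //.
  by move: xy; rewrite -ball_normE /= nmE ltcR => /ltW.
exists n => m nm_.
rewrite -lerBlDl; apply: le_trans xy_le.
apply: (@le_trans _ _ (nm x ^+ 2 - \sum_(0 <= i < n) modulus (ip x (e i)) ^+ 2)).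
  rewrite lerD2l lerN2 [leRHS](big_cat_nat (n := n)) //= lerDl.
  by apply: sumr_ge0 => i _; rewrite exprn_ge0 ?modulus_ge0.
rewrite -nm_residual ?iota_uniq //.
have -> : x - \sum_(0 <= i < n) ip x (e i) *: e i =
    (x - y) - \sum_(0 <= i < n) ip (x - y) (e i) *: e i.
  rewrite -addrA; congr (_ + _); rewrite {1}yP -opprD -big_split /=; congr (- _).
  by apply: eq_bigr => i _; rewrite -scalerDl linearBl /= addrC subrK.
rewrite nm_residual ?iota_uniq // gerBl.
by apply: sumr_ge0 => i _; rewrite exprn_ge0 ?modulus_ge0.
Qed.

End Bases.

(** * Diagonals of projections *)

Section Gram.
Variables (R : realType) (H : completeNormedModType R[i]).
Variable ip : {dot H for Num.conj}.
Hypothesis hilbert : norm_of_dot ip.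
Variables e u : nat -> H.
Hypothesis orth : forall i j, ip (e i) (e j) = (i == j)%:R.
Hypothesis dns : dense [set x : H | exists n (c : 'I_n -> R[i]), x = \sum_i c i *: e i].
(** When u k is the image of e k by an orthogonal projection, this
    combines the idempotence and the symmetry of the projection. *)
Hypothesis ue : forall k l, ip (u k) (u l) = ip (u k) (e l).
Local Open Scope sesquilinear_scope.

Local Notation t n := (nm (u n) ^+ 2).
Local Notation g k l := (modulus (ip (u k) (e l)) ^+ 2).

Lemma gram_sym k l : g k l = g l k.
Proof. by rewrite -!ue modulus_ipC. Qed.

(** By Parseval the left-hand side is the sum of the g k l over k < m <= l. By
    symmetry of g it can be summed by rows l >= m, and Bessel for u l against
    e l and the e k with k < m bounds such a row by t l - g l l, where
    g l l = (t l)^2. *)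
Lemma gram_defect m (eps : R) :
  (forall M, \sum_(m <= n < M) (t n - t n ^+ 2) <= eps) ->
  \sum_(0 <= k < m) (t k - \sum_(0 <= l < m) g k l) <= eps.
Proof.
move=> tail; apply/ler_addgt0Pr => del del_gt0.
pose del' := del / m.+1%:R.
have del'_gt0 : 0 < del' by rewrite divr_gt0.
have [n nP] := choice (fun k => parseval hilbert orth (u k) del'_gt0 dns).
(* A common cutoff for the Parseval approximations of u_0, ..., u_(m - 1). *)
pose M := (m + \sum_(0 <= k < m) n k)%N.
have tk k : (k < m)%N -> t k - \sum_(0 <= l < m) g k l <= \sum_(m <= l < M) g k l + del'.
  move=> km; rewrite lerBlDl addrA -big_cat_nat ?leq_addr //; apply: nP.
  rewrite /M (big_cat_nat (n := k)) ?(ltnW km) //= [X in (_ + (_ + X))%N]big_ltn //.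
  by do 2!apply: leq_trans (leq_addl _ _); exact: leq_addr.
apply: (@le_trans _ _ (\sum_(0 <= k < m) (\sum_(m <= l < M) g k l + del'))).
  by rewrite big_nat_cond [leRHS]big_nat_cond; apply: ler_sum => k /andP[/andP[_ /tk]].
rewrite big_split /= sumr_const_nat subn0; apply: lerD.
  rewrite exchange_big_nat /=; apply: le_trans (tail M).
  rewrite big_nat_cond [leRHS]big_nat_cond; apply: ler_sum => l /andP[/andP[ml _] _].
  have := @bessel _ _ _ hilbert e orth (l :: iota 0 m) (u l).
  rewrite cons_uniq iota_uniq mem_iota add0n -leqNgt ml big_cons => /(_ isT).
  rewrite -ue {1}(ip_nm hilbert) modulusR ger0_norm ?exprn_ge0 ?nm_ge0 //.
  rewrite lerBrDl; apply: le_trans; rewrite lerD2l.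
  rewrite /index_iota subn0; apply: ler_sum => k _; by rewrite gram_sym.
rewrite -mulr_natr /del' mulrAC ler_pdivrMr // ler_pM2l //.
by rewrite ler_nat.
Qed.

(** For w = sum v_i u_i and a = sum v_i e_i one has <w, w> = <w, a>, hence
    |w| <= |a|, which says that the Gram matrix of the u i is at most 1. Its trace
    defect is bounded by [gram_defect]. *)
Lemma gram_trace m (eps : R) :
  (forall M, \sum_(m <= n < M) (t n - t n ^+ 2) <= eps) ->
  exists k : nat, `|\sum_(0 <= n < m) t n - k%:R| <= 2 * eps.
Proof.
move=> /gram_defect defect.
pose G := \matrix_(i < m, j < m) ip (u i) (u j).
have Gherm : G \is hermsymmx.
  apply/is_hermitianmxP; rewrite expr0 scale1r; apply/matrixP => i j.
  by rewrite !mxE; exact: ipC.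
have Gpos (v : 'rV[R[i]]_m) : 0 <= (v *m G *m v ^t*) 0 0 <= (v *m v ^t*) 0 0.
  pose w := \sum_i v 0 i *: u i; pose a := \sum_i v 0 i *: e i.
  have ipw (b : nat -> H) : ip w (\sum_(j < m) v 0 j *: b j) =
     \sum_(j < m) (\sum_(i < m) v 0 i * ip (u i) (b j)) * Num.conj (v 0 j).
    rewrite linear_sumr; apply: eq_bigr => j _ /=.
    rewrite linearZr_LR /= mulrC; congr (_ * _).
    rewrite linear_sumlz; apply: eq_bigr => i _ /=; by rewrite linearZl_LR.
  have wG : (v *m G *m v ^t*) 0 0 = ip w w.
    rewrite [ip w w]ipw mxE; apply: eq_bigr => j _; rewrite !mxE; congr (_ * _).
    by apply: eq_bigr => i _; rewrite !mxE.
  have wa : ip w a = ip w w.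
    rewrite [LHS]ipw [RHS]ipw; apply: eq_bigr => j _; congr (_ * _).
    by apply: eq_bigr => i _; rewrite ue.
  have aa : (v *m v ^t*) 0 0 = ip a a.
    rewrite mxE linear_sumr; apply: eq_bigr => j _; rewrite !mxE linearZr_LR /= mulrC.
    congr (_ * _); rewrite linear_sumlz /= (bigD1 j) //= linearZl_LR /= orth eqxx mulr1.
    rewrite big1 ?addr0 // => k /negPf kj; rewrite linearZl_LR /= orth.
    by rewrite -[(_ == _ :> nat)]/(k == j) kj mulr0.
  rewrite wG aa !(ip_nm hilbert) ler0c exprn_ge0 ?nm_ge0 // lecR.
  have := nmB_sqr hilbert 1 w a; rewrite wa (ip_nm hilbert) /=.
  have := exprn_ge0 2 (nm_ge0 (w - 1%:C *: a)); lra.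
have [k kP] := trace_near_nat Gherm Gpos.
have trG : complex.Re (\tr G) = \sum_(0 <= n < m) t n.
  rewrite big_mkord /mxtrace raddf_sum; apply: eq_bigr => i _.
  by rewrite mxE (ip_nm hilbert).
have trGG : complex.Re (\tr (G *m G)) = \sum_(0 <= k < m) \sum_(0 <= l < m) g k l.
  rewrite big_mkord /mxtrace raddf_sum; apply: eq_bigr => i _.
  rewrite mxE raddf_sum big_mkord; apply: eq_bigr => j _.
  by rewrite !mxE (ipC _ (u j)) -ue -[_^*%C]/(Num.conj _) -sqr_modulus.
exists k; rewrite -trG; apply: le_trans kP _; rewrite ler_pM2l // trG trGG.
by rewrite -sumrB.
Qed.

End Gram.

(** * Summability and the geometry of the vertices *)

Section Summability.
Variable R : realType.

Lemma summableP (f : nat -> R) : (forall n, 0 <= f n) ->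
  (\sum_(0 <= n <oo) (f n)%:E < +oo)%E <->
  exists C : R, forall n, \sum_(0 <= k < n) f k <= C.
Proof.
move=> f_ge0; split.
  move=> fin; exists (fine (\sum_(0 <= n <oo) (f n)%:E)%E) => n.
  rewrite -lee_fin fineK ?ge0_fin_numE ?nneseries_ge0 //; last first.
    by move=> k _ _; rewrite lee_fin.
  rewrite -sumEFin; apply: nneseries_lim_ge => k _ _; by rewrite lee_fin.
case=> C fC; apply: (@le_lt_trans _ _ C%:E); last exact: ltry.
apply: lime_le.
  by apply: is_cvg_nneseries => k _ _; rewrite lee_fin.
by near=> n; rewrite sumEFin lee_fin.
Unshelve. all: by end_near. Qed.

Lemma summable_le (f g : nat -> R) (C : R) : (forall n, 0 <= f n) ->
  0 <= C -> (forall n, f n <= C * g n) ->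
  (exists D : R, forall n, \sum_(0 <= k < n) g k <= D) ->
  exists D : R, forall n, \sum_(0 <= k < n) f k <= D.
Proof.
move=> f0 C0 fg [D gD]; exists (C * D) => n.
apply: (@le_trans _ _ (C * \sum_(0 <= k < n) g k)); last by rewrite ler_wpM2l.
by rewrite mulr_sumr; apply: ler_sum.
Qed.

End Summability.

Section Vertices.
Variables (R : realType) (N : nat) (lam : 'I_N -> R[i]).

(** If lam i is nearest to z, every other vertex is at distance at least half
    the gap from z, which bounds the other factors from below. *)
Lemma dist_le_prod : (0 < N)%N -> injective lam ->
  exists2 C : R, 0 <= C & forall z,
    dist z (range lam) <= C * modulus (\prod_(i < N) (z - lam i)).
Proof.
move=> N0 inj; have [del del0 gap] := range_gap lam.
exists (((del / 2) ^+ N.-1)^-1) => [|z]; first by rewrite invr_ge0 exprn_ge0 // ltW ?divr_gt0.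
have [i iE] := dist_attained lam z N0.
have far j : j != i -> del / 2 <= modulus (z - lam j).
  move=> ji; have gapij : del <= modulus (lam i - lam j).
    by rewrite leNgt; apply/negP => /gap/inj/eqP; rewrite eq_sym (negPf ji).
  have near_i : modulus (z - lam i) <= modulus (z - lam j).
    rewrite -iE; apply: ge_inf; last by exists (lam j) => //; exists j.
    by exists 0 => _ [l _ <-]; exact: modulus_ge0.
  have := modulusD_le (z - lam j) (lam i - z).
  rewrite [z - _ + _]addrC addrA subrK [modulus (lam i - z)]modulusB; lra.
rewrite iE modulus_prod (bigD1 i) //= mulrCA -[leLHS]mulr1 ler_wpM2l ?modulus_ge0 //.
rewrite mulrC ler_pdivlMr ?exprn_gt0 ?divr_gt0 // mul1r.
have -> : (del / 2) ^+ N.-1 = \prod_(j | j != i) (del / 2).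
  by rewrite prodr_const cardC1 card_ord.
apply: ler_prod => j ji; rewrite far // ltW ?divr_gt0 //.
Qed.

(** By compactness, the hull of the other vertices stays at a positive distance c
    from lam i; and sum_j t j lam j - lam i is 1 - t i times the difference of
    a point of that hull and lam i. *)
Lemma vertex_gap i : ~ convex_hull lam [set~ i]%SET (lam i) ->
  exists2 c : R, 0 < c & forall t : 'I_N -> R, (forall j, 0 <= t j) -> \sum_j t j = 1 ->
    c * (1 - t i) <= modulus (\sum_j (t j)%:C * lam j - lam i).
Proof.
move=> vert.
pose lin (a : 'I_N -> R) (v : 'rV[R]_N) := \sum_(j | j != i) v 0 j * a j.
have lin_cont a : continuous (lin a).
  apply: continuous_big => [|j _]; first exact: add_continuous.
  move=> v; apply: (@continuousM _ _ (fun v : 'rV[R]_N => v 0 j) (fun=> a j)).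
    exact: coord_continuous.
  exact: cst_continuous.
pose K := [set v : 'rV[R]_N | forall j, `[0, 1]%classic (v 0 j)] `&`
  (lin (fun=> 1) @^-1` [set 1]).
have cK : compact K.
  apply: compact_closedI; first by apply: (@rV_compact R N (fun=> `[0, 1]%classic)) => j; exact: segment_compact.
  apply: preimage_closed; last exact: closed_eq.
  by move=> v _; exact: (lin_cont (fun=> 1) v).
pose re j := complex.Re (lam j - lam i); pose im j := complex.Im (lam j - lam i).
(* F v is the squared distance from lam i to the point with coordinates v;
   working with squares makes F polynomial in the coordinates. *)
pose F v := lin re v ^+ 2 + lin im v ^+ 2.
have sq_cont a : continuous (fun v => lin a v ^+ 2).
  by move=> v; apply: (@continuousM _ _ (lin a) (lin a)); exact: lin_cont.
have F_cont : continuous F.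
  by move=> v; apply: (@continuousD _ _ _ (fun v => lin re v ^+ 2)); exact: sq_cont.
have FE v : (F v)%:C = `|\sum_(j | j != i) (v 0 j)%:C * (lam j - lam i)| ^+ 2.
  rewrite -add_Re2_Im2 /F /lin !raddf_sum; congr ((_ ^+ 2 + _ ^+ 2)%:C).
    by apply: eq_bigr => j _; rewrite /re; case: (lam j - lam i) => a b; rewrite /= mul0r subr0.
  by apply: eq_bigr => j _; rewrite /im; case: (lam j - lam i) => a b; rewrite /= mul0r addr0.
have Fpos v : K v -> 0 < F v.
  move=> [v01 v1]; rewrite lt_def; apply/andP; split; last by rewrite addr_ge0 // sqr_ge0.
  apply/eqP => F0; apply: vert; exists (fun j => v 0 j); split.
  - by move=> j; have := v01 j; rewrite /= in_itv /= => /andP[].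
  - rewrite -[RHS]v1; apply: eq_big => j; first by rewrite !inE.
    by rewrite mulr1.
  - have /eqP := FE v; rewrite F0 eq_sym sqrf_eq0 normr_eq0.
    under eq_bigr => j _ do rewrite mulrBr.
    rewrite sumrB subr_eq0 => /eqP E.
    have <- : \sum_(j | j != i) (v 0 j)%:C * lam i = lam i.
      rewrite -mulr_suml -rmorph_sum /=.
      have -> : \sum_(j | j != i) v 0 j = 1.
        by rewrite -[RHS]v1; apply: eq_bigr => j _; rewrite mulr1.
      by rewrite mul1r.
    by rewrite -E; apply: eq_bigl => j; rewrite !inE.
have [c c_gt0 cP] : exists2 c : R, 0 < c & forall v, K v -> c ^+ 2 <= F v.
  have [K0|/set0P/negP/negPn/eqP K0] := pselect (K !=set0); last first.
    by exists 1 => // v; rewrite K0.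
  have [v Kv vP] := EVT_min_rV K0 cK (continuous_subspaceT F_cont).
  have Fv := Fpos v (set_mem Kv).
  exists (Num.sqrt (F v)); first by rewrite sqrtr_gt0.
  by move=> w Kw; rewrite sqr_sqrtr ?(ltW Fv) //; apply/vP/mem_set.
exists c => // t t_ge0 t1.
have tD : 1 - t i = \sum_(j | j != i) t j by rewrite -t1 (bigD1 i) //= addrAC subrr add0r.
have zE : \sum_j (t j)%:C * lam j - lam i = \sum_(j | j != i) (t j)%:C * (lam j - lam i).
  have {1}-> : lam i = \sum_j (t j)%:C * lam i by rewrite -mulr_suml -rmorph_sum t1 mul1r.
  rewrite -sumrB (bigD1 i) //= subrr add0r; apply: eq_bigr => j _; by rewrite mulrBr.
have [ti|ti] := eqVneq (1 - t i) 0; first by rewrite ti mulr0 modulus_ge0.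
have s_gt0 : 0 < 1 - t i by rewrite lt_def ti /= tD sumr_ge0.
pose v : 'rV[R]_N := \row_j (if j == i then 0 else t j / (1 - t i)).
have vE j : j != i -> v 0 j = t j / (1 - t i) by move=> /negPf ji; rewrite mxE ji.
have Kv : K v.
  split=> [j|].
    rewrite /= in_itv /= mxE; case: eqVneq => [_|ji]; first by rewrite lexx ler01.
    rewrite divr_ge0 ?(ltW s_gt0) //= ler_pdivrMr // mul1r tD (bigD1 j) //= lerDl.
    by rewrite sumr_ge0.
  rewrite /lin /=; under eq_bigr => j ji do rewrite vE // mulr1.
  by rewrite -mulr_suml -tD divff.
rewrite -ler_sqr ?nnegrE ?modulus_ge0 ?mulr_ge0 ?(ltW c_gt0) ?(ltW s_gt0) // exprMn.
have -> : modulus (\sum_j (t j)%:C * lam j - lam i) ^+ 2 = F v * (1 - t i) ^+ 2.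
  apply: complexI; rewrite rmorphXn rmorphM /= -modulusE FE zE.
  have -> : \sum_(j | j != i) (t j)%:C * (lam j - lam i) =
      (1 - t i)%:C * \sum_(j | j != i) (v 0 j)%:C * (lam j - lam i).
    rewrite mulr_sumr; apply: eq_bigr => j ji.
    by rewrite mulrA -rmorphM /= vE // [(1 - t i) * _]mulrC divfK.
  rewrite normrM exprMn mulrC rmorphXn /=; congr (_ * _ ^+ 2).
  by rewrite ger0_norm // ler0c ltW.
by rewrite ler_pM2r ?exprn_gt0 //; exact: cP.
Qed.

End Vertices.

(** * The weights of a diagonal and their integral sums *)

Section DiagonalWeights.
Variables (R : realType) (H : completeNormedModType R[i]).
Variable ip : {dot H for Num.conj}.
Hypothesis hilbert : norm_of_dot ip.

(** The weight t i n is the squared norm of the component of e_n in the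
    eigenspace of lam i; its integrality property is that of diagonals of
    projections. *)
Lemma diagonal_weights (N : nat) (lam : 'I_N -> R[i]) (d : nat -> R[i])
    (A : {linear H -> H}) : injective lam ->
  bounded_op A -> normal_op ip A -> spectrum A `<=` range lam -> is_diagonal ip d A ->
  exists t : 'I_N -> nat -> R, [/\ forall i n, 0 <= t i n, forall n, \sum_i t i n = 1,
    forall n, d n = \sum_i (t i n)%:C * lam i &
    forall i m (eps : R), (forall M, \sum_(m <= n < M) (t i n - t i n ^+ 2) <= eps) ->
      exists k : nat, `|\sum_(0 <= n < m) t i n - k%:R| <= 2 * eps].
Proof.
move=> inj Abd Anorm spA [e [orth dns] dE].
pose s := [seq lam i | i <- enum 'I_N].
have A0 x : prod_shift A s x = 0.
  apply: (prod_shift_eq0 hilbert) => // z /spA[i _ <-].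
  by apply: map_f; rewrite mem_enum.
have /choice[u uP] : forall n, exists y : 'I_N -> H,
    (forall i, A (y i) = lam i *: y i) /\ e n = \sum_i y i.
  move=> n; have [y Ay yE] := eigen_decomposition inj (enum_uniq 'I_N) (A0 (e n)).
  by exists y; split=> //; rewrite yE big_enum.
have [B [Bbd AB comAB]] := Anorm.
have uorth i j k l : i != j -> ip (u k i) (u l j) = 0.
  move=> ij; have [/(_ i) Ai _] := uP k; have [/(_ j) Aj _] := uP l.
  by apply: (eigen_orthogonal hilbert AB comAB Ai Aj); rewrite (inj_eq inj).
have ue i k l : ip (u k i) (u l i) = ip (u k i) (e l).
  rewrite (uP l).2 linear_sumr (bigD1 i) //= big1 ?addr0 // => j ji.
  by apply: uorth; rewrite eq_sym.
have ue' i n : ip (u n i) (e n) = (nm (u n i) ^+ 2)%:C by rewrite -ue (ip_nm hilbert).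
exists (fun i n => nm (u n i) ^+ 2); split.
- by move=> i n; rewrite exprn_ge0 ?nm_ge0.
- move=> n; apply: complexI; rewrite raddf_sum /=.
  under eq_bigr => i _ do rewrite -ue'.
  have <- : ip (e n) (e n) = \sum_i ip (u n i) (e n).
    by rewrite [X in ip X _ = _](uP n).2 linear_sumlz.
  by rewrite orth eqxx.
- move=> n; rewrite dE {1}(uP n).2 linear_sum linear_sumlz; apply: eq_bigr => i _ /=.
  by rewrite (uP n).1 linearZl_LR /= ue' mulrC.
- move=> i m eps; exact: (@gram_trace _ _ _ hilbert e (fun n => u n i) orth dns (ue i)).
Qed.

End DiagonalWeights.

Section IntegerSum.
Variable R : realType.

Lemma summable_tail (w : nat -> R) (eps : R) : 0 < eps -> (forall n, 0 <= w n) ->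
  (exists D : R, forall n, \sum_(0 <= k < n) w k <= D) ->
  exists m0, forall m M, (m0 <= m)%N -> \sum_(m <= n < M) w n <= eps.
Proof.
move=> eps_gt0 w0 [D wD].
pose S := range (fun n => \sum_(0 <= k < n) w k).
have supS : has_sup S.
  by split; [exists 0, 0%N; rewrite ?big_nil // big_geq | exists D => _ [n _ <-]].
have [_ [m0 _ <-] lt_m0] := sup_adherent eps_gt0 supS.
exists m0 => m M le_m.
have [le_M|lt_M] := leqP M m; first by rewrite big_geq // ltW.
have : \sum_(0 <= k < M) w k <= sup S by apply: ub_le_sup; [case: supS | exists M].
rewrite (big_cat_nat (n := m)) ?(ltnW lt_M) //=.
rewrite [X in X + _ <= _](big_cat_nat (n := m0)) //=.
have : 0 <= \sum_(m0 <= k < m) w k by exact: sumr_ge0.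
move: lt_m0; rewrite -/S; lra.
Qed.

(** An integer at distance at most 1/4 from L is unique, so it is the one
    given by every smaller precision. *)
Lemma int_of_approx (L : R) : (forall eps : R, 0 < eps -> exists z : int, `|L - z%:~R| <= eps) ->
  exists z : int, L = z%:~R.
Proof.
move=> nearL; have [|z zP] := nearL 4^-1; first by [].
exists z; apply/eqP; rewrite -subr_eq0 -normr_le0; apply/ler_addgt0Pr => eps eps_gt0.
rewrite add0r; have [|z' z'P] := nearL (Num.min eps 4^-1); first by rewrite lt_min eps_gt0 /=.
suff <- : z' = z by apply: le_trans z'P _; rewrite ge_min lexx.
apply/eqP; rewrite -subr_eq0 -absz_eq0 -leqn0 -ltnS -ltz_nat abszE -(ltr_int R) intr_norm.
rewrite rmorphB /=; apply: (@le_lt_trans _ _ (4^-1 + 4^-1)); last by lra.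
rewrite (_ : z'%:~R - z%:~R = (L - z%:~R) - (L - z'%:~R)); last by ring.
apply: le_trans (ler_normB _ _) _; apply: lerD => //.
by apply: le_trans z'P _; rewrite ge_min lexx orbT.
Qed.

(** The b n being integers, the partial sums of t n - b n are as close to
    integers as those of t n, so that their limit is a limit of integers. *)
Lemma series_to_int (t w : nat -> R) (b : nat -> bool) :
  (forall n, 0 <= w n) -> (exists D : R, forall n, \sum_(0 <= k < n) w k <= D) ->
  (forall n, `|t n - (b n)%:R| <= w n) -> (forall n, t n - t n ^+ 2 <= w n) ->
  (forall m (eps : R), (forall M, \sum_(m <= n < M) (t n - t n ^+ 2) <= eps) ->
      exists k : nat, `|\sum_(0 <= n < m) t n - k%:R| <= 2 * eps) ->
  exists z : int, series (fun n => t n - (b n)%:R) @ \oo --> (z%:~R : R).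
Proof.
move=> w0 wD tb tw near_t.
have cvg_w : cvgn (series w).
  apply: nondecreasing_is_cvgn; first exact: nondecreasing_series.
  by case: wD => D wD; exists D => _ [n _ <-]; exact: wD.
have /cvg_ex[/= L cvgL] : cvgn (series (fun n => t n - (b n)%:R)).
  by apply: normed_cvg; apply: series_le_cvg cvg_w => n;
    [exact: normr_ge0 | exact: w0 | exact: tb].
suff /int_of_approx[z Lz] : forall eps : R, 0 < eps -> exists z : int, `|L - z%:~R| <= eps.
  by exists z; rewrite -Lz.
move=> eps eps_gt0.
have e2 : 0 < eps / 2 by rewrite divr_gt0.
have e4 : 0 < eps / 4 by rewrite divr_gt0.
have [m0 m0P] := summable_tail e4 w0 wD.
move/cvgrPdist_le : cvgL => /(_ _ e2)[m1 _ m1P].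
pose m := maxn m0 m1.
have [M|k kP] := near_t m (eps / 4).
  apply: le_trans (m0P m M (leq_maxl _ _)); exact: ler_sum.
exists (k%:Z - (\sum_(0 <= n < m) b n)%:Z).
have := m1P m (leq_maxr _ _); rewrite /= /series /= sumrB => LP.
rewrite rmorphB /= -!pmulrn natr_sum.
set S := \sum_(0 <= n < m) t n in kP LP; set C := \sum_(0 <= n < m) _ in LP *.
rewrite (_ : L - (k%:R - C) = (L - (S - C)) + (S - k%:R)); last by ring.
apply: le_trans (ler_normD _ _) _; lra.
Qed.

End IntegerSum.

(** * The renormalized sum *)

Section Assembly.
Variable R : realType.

Lemma coset_zero_sum (N : nat) (lam : 'I_N -> R[i]) (z : R[i]) :
  z \in zero_sum_combs lam -> coset lam z = 0.
Proof.
(* The zero of the quotient is defined as a locked coset of 0. *)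
move=> zK; have -> : 0 = coset lam 0 by exact/esym/(lock (coset lam 0)).
by apply/eqP; rewrite -Quotient.idealrBE subr0.
Qed.

Lemma csum_weights (N : nat) (lam : 'I_N -> R[i]) (a : nat -> R[i])
    (s : 'I_N -> nat -> R) (L : 'I_N -> R) :
  (forall n, a n = \sum_i lam i * (s i n)%:C) ->
  (forall i, series (s i) @ \oo --> L i) -> csum a = \sum_i lam i * (L i)%:C.
Proof.
move=> aE cvgL; apply: (cvg_lim (@norm_hausdorff R[i] R[i]^o)).
have -> : series (a : nat -> R[i]^o) =
    (fun m => \sum_i (lam i : R[i]^o) * ((series (s i) m)%:C : R[i]^o)).
  apply/funext => m; rewrite /series /=; under eq_bigr => n _ do rewrite aE.
  by rewrite exchange_big; apply: eq_bigr => i _; rewrite raddf_sum mulr_sumr.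
apply: cvg_big => [|i _]; first exact: add_continuous.
apply: cvgM; first exact: cvg_cst.
apply/cvgrPdist_lt => /= eps eps_gt0.
have /complex_realP[e epsE] : eps \is Num.real by rewrite gtr0_real.
rewrite epsE ltcR in eps_gt0 *.
move/cvgrPdist_lt : (cvgL i) => /(_ _ eps_gt0); apply: filterS => m.
by rewrite -rmorphB /= modulusE ltcR modulusR.
Qed.

End Assembly.

Theorem theorem6p1 (R : realType)
    (H : completeNormedModType R[i]) (ip : {dot H for Num.conj})
    (hilbert : norm_of_dot ip) (sep : separable_space H)
    (infdim : infinite_dimensional H)
    (N : nat) (N_ge2 : (2 <= N)%N) (lam : 'I_N -> R[i])
    (vertices : convex_position lam)
    (d : nat -> R[i])
    (d_in_P : forall n, convex_hull lam [set: 'I_N]%SET (d n))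
    (f_summable : abs_summable (fun n => \prod_(i < N) (d n - lam i))) :
  Lim1 (range lam) d /\
  ((exists2 A, normal_with_spectrum ip (range lam) A & is_diagonal ip d A) ->
     renorm_sum lam d = 0).
Proof.
have N_gt0 : (0 < N)%N by apply: leq_trans N_ge2.
have [inj gap] := vertices.
have dist_ge0 z : 0 <= dist z (range lam).
  by have [i ->] := dist_attained lam z N_gt0; exact: modulus_ge0.
have dLim : Lim1 (range lam) d.
  split.
    exists (\sum_i modulus (lam i)) => n; have [t [t0 t1 ->]] := d_in_P n.
    rewrite (eq_bigl xpredT) in t1; last by move=> i; rewrite inE.
    rewrite (eq_bigl xpredT); last by move=> i; rewrite inE.
    apply: le_trans (modulus_sum _ _ _) _; apply: ler_sum => i _.
    rewrite modulusM modulusR ger0_norm // -[leRHS]mul1r ler_wpM2r ?modulus_ge0 //.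
    by rewrite -t1 (bigD1 i) //= lerDl sumr_ge0.
  have [C C0 CP] := dist_le_prod N_gt0 inj.
  apply/summableP => //.
  pose g n := modulus (\prod_(i < N) (d n - lam i)).
  apply: (summable_le (C := C) (g := g)) => //.
  by apply/summableP => // n; exact: modulus_ge0.
split=> // -[A [Abd Anorm spA _] diagA].
have spA' : spectrum A `<=` range lam by rewrite spA.
have [t [t_ge0 t_sum dE t_int]] := diagonal_weights hilbert inj Abd Anorm spA' diagA.
have [x apx] := Lim1_approximants N_gt0 dLim.
rewrite (renorm_sumE apx); case: apx => Xx sum_x.
have /choice[b bE] : forall n, exists i, lam i = x n by move=> n; have [i _ <-] := Xx n; exists i.
have /choice[c cP] : forall i, exists c : R, 0 < c /\ forall t : 'I_N -> R,
    (forall j, 0 <= t j) -> \sum_j t j = 1 ->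
    c * (1 - t i) <= modulus (\sum_j (t j)%:C * lam j - lam i).
  by move=> i; have [c c0 cP] := vertex_gap (gap i); exists c.
(* w dominates, for every i, both |t i n - [b n = i]| and the defect
   t i n - t i n ^+ 2, and is summable by the gap at each vertex. *)
pose w n := 1 - t (b n) n.
have wE n : w n = \sum_(j | j != b n) t j n.
  by rewrite /w -(t_sum n) (bigD1 (b n)) //= addrAC subrr add0r.
have w_ge0 n : 0 <= w n by rewrite wE sumr_ge0.
have le_w n i : i != b n -> t i n <= w n.
  by move=> ib; rewrite wE (bigD1 i) //= lerDl sumr_ge0.
have w_bounded : exists D : R, forall n, \sum_(0 <= k < n) w k <= D.
  apply: (summable_le (g := fun n => modulus (d n - x n)) (C := \sum_i (c i)^-1)) => //.
  - by apply: sumr_ge0 => i _; rewrite invr_ge0 ltW //; case: (cP i).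
  - move=> n; have [cb_gt0 cb] := cP (b n).
    have /(_ (t_ge0^~ n) (t_sum n)) := cb (t^~ n); rewrite -dE bE -/(w n) => cw.
    have {}cw : w n <= (c (b n))^-1 * modulus (d n - x n).
      by rewrite mulrC ler_pdivlMr // mulrC.
    apply: le_trans cw _; rewrite ler_wpM2r ?modulus_ge0 // (bigD1 (b n)) //= lerDl.
    by apply: sumr_ge0 => i _; rewrite invr_ge0 ltW //; case: (cP i).
  - by apply/summableP => // n; exact: modulus_ge0.
have t_le1 i n : t i n <= 1 by rewrite -(t_sum n) (bigD1 i) //= lerDl sumr_ge0.
have t_bit i n : `|t i n - (b n == i)%:R| <= w n.
  have [<-|ib] := eqVneq (b n) i; first by rewrite distrC ger0_norm ?subr_ge0.
  by rewrite subr0 ger0_norm // le_w // eq_sym.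
have t_defect i n : t i n - t i n ^+ 2 <= w n.
  have := t_ge0 i n; have := t_le1 i n.
  have [<-|ib] := eqVneq (b n) i; first by rewrite /w; nra.
  by have := le_w n i; rewrite eq_sym => /(_ ib); nra.
have /choice[nu nuP] : forall i, exists z : int,
    series (fun n => t i n - (b n == i)%:R) @ \oo --> (z%:~R : R).
  move=> i; exact: (series_to_int w_ge0 w_bounded (t_bit i) (t_defect i) (t_int i)).
have dxE n : d n - x n = \sum_i lam i * (t i n - (b n == i)%:R)%:C.
  under eq_bigr => i _ do rewrite rmorphB mulrBr mulrC.
  rewrite sumrB -dE; congr (_ - _); rewrite -bE (bigD1 (b n)) //= eqxx mulr1.
  by rewrite big1 ?addr0 // => i; rewrite eq_sym => /negPf ->; rewrite mulr0.
rewrite (csum_weights dxE nuP); apply: coset_zero_sum; apply/asboolP; exists nu; split.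
  have sum_cvg : (fun m => \sum_i series (fun n => t i n - (b n == i)%:R) m) @ \oo
      --> (\sum_i (nu i)%:~R : R).
    by apply: cvg_big => [|i _]; [exact: add_continuous | exact: nuP].
  have sum0 : (fun m => \sum_i series (fun n => t i n - (b n == i)%:R) m) = fun=> 0 :> R.
    apply/funext => m; rewrite /series /= exchange_big /= big1 // => n _.
    rewrite sumrB t_sum (bigD1 (b n)) //= eqxx big1 ?addr0 ?subrr // => i.
    by rewrite eq_sym => /negPf ->.
  rewrite sum0 in sum_cvg.
  have := cvg_lim (@norm_hausdorff R R) sum_cvg; rewrite lim_cst // => /(_ _)/esym/eqP.
  by rewrite -rmorph_sum intr_eq0 => /eqP.
apply: eq_bigr => i _; rewrite -[RHS]mulrzr; congr (_ * _).
by rewrite rmorph_int.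
Qed.
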